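(* Let $H$ be a complex Hilbert space and let $M_0,M_1\in L(H)$ be such that $R(M_0)$ is closed and the linear operator pencil $\mathcal{M}$ associated with $(M_0,M_1)$ is regular. Then $\sigma_{\mathrm{IV}}(\mathcal{M})=\sigma(\mathcal{M})$.
   Context: $L(H)$ is the space of bounded linear operators on $H$; $R(M_0)$ denotes the range. For a closed subspace $S\subseteq H$, $\iota_S:S\hookrightarrow H$ is the canonical embedding and $\iota_S^{*}:H\to S$ its adjoint (the orthogonal projection onto $S$). The linear operator pencil associated with $(M_0,M_1)$ is $\mathcal{M}(z)=zM_0+M_1$, $z\in\mathbb{C}$. It is called regular (of index $0$) if there is $\nu\in\mathbb{R}$ such that $zM_0+M_1$ is boundedly invertible for all $z$ with $\operatorname{Re}z>\nu$ and $z\mapsto(zM_0+M_1)^{-1}\in L(H)$ is bounded on $\{z:\operatorname{Re}z>\nu\}$. Let $\mathrm{IV}:=\{x\in H:M_1x\in R(M_0)\}$, a closed subspace of $H$; the operator $\iota_{R(M_0)}^{*}M_0\iota_{\mathrm{IV}}:\mathrm{IV}\to R(M_0)$ is continuously invertible. Define $$\sigma_{\mathrm{IV}}(\mathcal{M}):=\sigma\left(-\left(\iota_{R(M_0)}^{*}M_0\iota_{\mathrm{IV}}\right)^{-1}\left(\iota_{R(M_0)}^{*}M_1\iota_{\mathrm{IV}}\right)\right)$$ (spectrum of a bounded operator on $\mathrm{IV}$) and $\sigma(\mathcal{M}):=\{z\in\mathbb{C}:0\in\sigma(zM_0+M_1)\}$. *)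

(* Defs.v *)
From HB Require Import structures.
From mathcomp Require Import all_boot all_order all_algebra.
From mathcomp Require Import sesquilinear complex.
From mathcomp Require Import boolp classical_sets functions reals.
From mathcomp Require Import topology normedtype.

Set Implicit Arguments.
Unset Strict Implicit.
Unset Printing Implicit Defensive.

Import Order.TTheory GRing.Theory Num.Theory.
Import numFieldNormedType.Exports.

Local Open Scope classical_set_scope.
Local Open Scope ring_scope.

(* The inner product is linear in its first argument and conjugate-linear in
   its second one, which is the convention of {dot _ for _}. *)
HB.mixin Record isHilbert (R : realType) H & CompleteNormedModule R[i] H := {
  inner : {dot H for (@Num.conj R[i])};
  inner_norm : forall x : H, inner x x = `|x| ^+ 2
}.

#[short(type="hilbertType")]
HB.structure Definition Hilbert (R : realType) :=
  {H of CompleteNormedModule R[i] H & isHilbert R H}.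

Section BoundedOperators.
Context (R : realType) (V W : normedModType R[i]).

(* The norm is R[i]-valued, hence so is the bound K. *)
Definition bounded_linear (f : V -> W) : Prop :=
  linear f /\ exists K : R[i], forall x, `|f x| <= K * `|x|.

Definition bounded_pred : {pred V -> W} := fun f => `[< bounded_linear f >].

Record bounded_op :=
  BoundedOp { bop_fun :> V -> W; bop_subproof : bop_fun \in bounded_pred }.

HB.instance Definition _ := [isSub of bounded_op for bop_fun].
HB.instance Definition _ := [Choice of bounded_op by <:].

Lemma bounded_op_submod : submod_closed bounded_pred.
Proof.
split=> [|a f g /asboolP[lf [Kf fK]] /asboolP[lg [Kg gK]]]; apply/asboolP; split.
- by move=> a x y; rewrite [RHS]addr0 scaler0.
- by exists 0 => x; rewrite normr0 mul0r.
- move=> b x y; rewrite !fctE lf lg !scalerDr !scalerA [a * b]mulrC.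
  by rewrite addrACA.
- exists (`|a| * Kf + Kg) => x; rewrite !fctE (le_trans (ler_normD _ _))//.
  by rewrite mulrDl lerD// normrZ -mulrA ler_wpM2l.
Qed.

HB.instance Definition _ :=
  GRing.isSubmodClosed.Build _ _ bounded_pred bounded_op_submod.
HB.instance Definition _ := [SubChoice_isSubLmodule of bounded_op by <:].

Lemma bop_bounded_linear (A : bounded_op) : bounded_linear A.
Proof. exact/asboolP/(bop_subproof A). Qed.

HB.instance Definition _ (A : bounded_op) :=
  GRing.isLinear.Build _ _ _ _ (bop_fun A) (bop_bounded_linear A).1.

Definition mk_bop (f : V -> W) (bf : bounded_linear f) : bounded_op :=
  BoundedOp (asboolT bf).

Lemma bop_bound (A : bounded_op) :
  exists2 K : R[i], 0 <= K & forall x, `|A x| <= K * `|x|.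
Proof.
have [_ [K AK]] := bop_bounded_linear A; exists `|K| => // x.
have [->|x0] := eqVneq x 0; first by rewrite linear0 !normr0 mulr0.
have := le_trans (normr_ge0 _) (AK x).
by rewrite pmulr_lge0 ?normr_gt0// => K0; rewrite (ger0_norm K0) AK.
Qed.

Lemma bop_continuous (A : bounded_op) : continuous A.
Proof.
have [K K0 AK] := bop_bound A.
apply: bounded_linear_continuous; apply/linear_boundedP.
exists K; split=> [|r Kr x]; first exact: ger0_real.
by rewrite (le_trans (AK x))// ler_wpM2r// ltW.
Qed.

Definition opnorm (A : bounded_op) : R :=
  sup [set complex.Re `|A x| | x in [set x : V | `|x| <= 1]].

End BoundedOperators.

Section OperatorAlgebra.
Context (R : realType).
Implicit Types U V W : normedModType R[i].

Lemma idop_subproof V : bounded_linear (@idfun V).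
Proof. by split=> //; exists 1 => x; rewrite mul1r. Qed.

Definition idop V : bounded_op V V := mk_bop (@idop_subproof V).

Lemma compop_subproof U V W (A : bounded_op V W) (B : bounded_op U V) :
  bounded_linear (A \o B).
Proof.
have [KA KA0 AK] := bop_bound A; have [KB _ BK] := bop_bound B.
split; first by move=> a x y /=; rewrite !linearP.
by exists (KA * KB) => x; rewrite -mulrA (le_trans (AK _))// ler_wpM2l.
Qed.

Definition compop U V W (A : bounded_op V W) (B : bounded_op U V)
  : bounded_op U W := mk_bop (compop_subproof A B).

Definition is_inverse V W (A : bounded_op V W) (B : bounded_op W V) : Prop :=
  cancel A B /\ cancel B A.

Definition invertible V W (A : bounded_op V W) : Prop :=
  exists B, is_inverse A B.

(* Total: 0 when A is not boundedly invertible; otherwise the inverse is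
   unique. *)
Definition invop V W (A : bounded_op V W) : bounded_op W V :=
  xget 0 (is_inverse A).

Definition spectrum V (A : bounded_op V V) : set R[i] :=
  [set z | ~ invertible (z *: idop V - A)].

End OperatorAlgebra.

(* Total by choice; the adjoint exists (and is unique) between Hilbert
   spaces. *)
Definition adjop (R : realType) (V W : hilbertType R) (A : bounded_op V W)
  : bounded_op W V :=
  xget 0 [set B : bounded_op W V | forall x y, inner (A x) y = inner x (B y)].

Section ClosedSubspaces.
Context (R : realType) (H : hilbertType R).

Record closed_subspace := ClosedSubspace {
  csub_set :> set H;
  csub_submod : submod_closed (mem csub_set);
  csub_closed : closed csub_set
}.

Context (S : closed_subspace).

Definition csub_pred : {pred H} := mem (csub_set S).

(* A closed subspace seen as a Hilbert space in its own right. *)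
Record csub := CSub { csub_val : H; csub_valP : csub_val \in csub_pred }.

HB.instance Definition _ :=
  GRing.isSubmodClosed.Build _ _ csub_pred (csub_submod S).
HB.instance Definition _ := [isSub of csub for csub_val].
HB.instance Definition _ := [Choice of csub by <:].
HB.instance Definition _ := [SubChoice_isSubLmodule of csub by <:].

Let nrm (x : csub) : R[i] := `|csub_val x|.

Let nrmD x y : nrm (x + y) <= nrm x + nrm y.
Proof. exact: ler_normD. Qed.

Let nrmZ l x : nrm (l *: x) = `|l| * nrm x.
Proof. exact: normrZ. Qed.

Let nrm_eq0 x : nrm x = 0 -> x = 0.
Proof. by move/normr0_eq0 => x0; apply/val_inj; rewrite /= x0. Qed.

HB.instance Definition _ := Lmodule_isNormed.Build _ csub nrmD nrmZ nrm_eq0.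

Lemma csub_complete (F : set_system csub) : ProperFilter F -> cauchy F -> cvg F.
Proof.
move=> FF /cauchyP Fc; pose G := csub_val @ F.
have Gc : cauchy G.
  apply/cauchyP => e e0; have [x xF] := Fc e e0.
  exists (csub_val x); change (F (csub_val @^-1` ball (csub_val x) e)).
  by apply: filterS xF => y; rewrite -!ball_normE.
have /cvg_ex[l Gl] : cvg G by exact: cauchy_cvg.
have Sl : csub_set S l.
  apply: (@closed_cvg _ _ F FF csub_val (csub_set S) (@csub_closed S) _ l Gl).
  by apply: nearW => x; exact/set_mem/csub_valP.
apply/cvg_ex; exists (CSub (mem_set Sl)).
apply/cvgrPdist_lt => e e0.
exact: (cvgrPdist_lt _ _).1 Gl e e0.
Qed.

HB.instance Definition _ := Uniform_isComplete.Build csub csub_complete.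

Definition csub_inner (x y : csub) : R[i] := inner (csub_val x) (csub_val y).

Lemma csub_inner_linearl y : scalar (csub_inner^~ y).
Proof. by move=> a u v; rewrite /csub_inner /= linearPl. Qed.

Lemma csub_inner_linearr x :
  linear_for (@Num.conj R[i] \; *%R) (csub_inner x).
Proof. by move=> a u v; rewrite /csub_inner /= linearPr. Qed.

HB.instance Definition _ :=
  bilinear_isBilinear.Build R[i] csub csub R[i] _ _ csub_inner
    (csub_inner_linearl, csub_inner_linearr).

Lemma csub_inner_sym x y :
  csub_inner x y = (-1) ^+ false * (csub_inner y x)^*.
Proof. exact: hermC. Qed.

HB.instance Definition _ :=
  isHermitianSesquilinear.Build R[i] csub false (@Num.conj R[i]) csub_inner
    csub_inner_sym.

Lemma csub_inner_gt0 x : x != 0 -> 0 < csub_inner x x.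
Proof. by move=> x0; exact: neq0_dnorm_gt0. Qed.

HB.instance Definition _ :=
  isDotProduct.Build R[i] csub csub_inner csub_inner_gt0.

Lemma csub_inner_norm x : csub_inner x x = `|x| ^+ 2.
Proof. exact: inner_norm. Qed.

HB.instance Definition _ := isHilbert.Build R csub csub_inner_norm.

Lemma embop_subproof : bounded_linear csub_val.
Proof. by split=> //; exists 1 => x; rewrite mul1r. Qed.

Definition embop : bounded_op csub H := mk_bop embop_subproof.

End ClosedSubspaces.

Section Pencil.
Context (R : realType) (H : hilbertType R) (M0 M1 : bounded_op H H).

Definition pencil (z : R[i]) : bounded_op H H := z *: M0 + M1.

Definition regular_pencil : Prop :=
  exists nu : R,
    (forall z : R[i], nu < complex.Re z -> invertible (pencil z)) /\
    exists K : R, forall z : R[i], nu < complex.Re z ->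
      opnorm (invop (pencil z)) <= K.

Definition sigma_pencil : set R[i] := [set z | spectrum (pencil z) 0].

Context (closed_range : closed (range M0)).

Lemma range_submod : submod_closed (mem (range M0)).
Proof.
split=> [|a x y]; first by apply/mem_set; exists 0 => //; rewrite linear0.
move=> /set_mem[u _ <-] /set_mem[v _ <-]; apply/mem_set.
by exists (a *: u + v) => //; rewrite linearP.
Qed.

Definition range_csub : closed_subspace H :=
  ClosedSubspace range_submod closed_range.

Definition IV : set H := [set x | range M0 (M1 x)].

Lemma IV_submod : submod_closed (mem IV).
Proof.
have [R0 RP] := range_submod; split=> [|a x y].
  by apply/mem_set; rewrite /IV/= linear0; exact: set_mem R0.
move=> /set_mem Rx /set_mem Ry; apply/mem_set; rewrite /IV/= linearP.
exact/set_mem/(RP a _ _ (mem_set Rx) (mem_set Ry)).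
Qed.

Lemma IV_closed : closed IV.
Proof.
exact: (proj1 (continuous_closedP _) (@bop_continuous _ _ _ M1) _ closed_range).
Qed.

Definition IV_csub : closed_subspace H := ClosedSubspace IV_submod IV_closed.

Definition compress (A : bounded_op H H)
  : bounded_op (csub IV_csub) (csub range_csub) :=
  compop (adjop (embop range_csub)) (compop A (embop IV_csub)).

Definition sigma_IV : set R[i] :=
  spectrum (- compop (invop (compress M0)) (compress M1)).

End Pencil.

(* Main.v *)
Require Import Defs.
From HB Require Import structures.
From mathcomp Require Import all_boot all_order all_algebra.
From mathcomp Require Import sesquilinear complex boolp classical_sets reals.
From mathcomp Require Import topology normedtype sequences ring lra.

Set Implicit Arguments.
Unset Strict Implicit.
Unset Printing Implicit Defensive.

Import Order.TTheory GRing.Theory Num.Theory.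
Import numFieldNormedType.Exports.

Local Open Scope classical_set_scope.
Local Open Scope ring_scope.
Local Open Scope complex_scope.

(** Write T(z) = z M0 + M1, and let A0, A1 : IV -> R(M0) be the compressions of
    M0 and M1.  Since M1 maps IV into R(M0), no projection really takes place:
    A0 and A1 are the restrictions of M0 and M1, and IV is the preimage of
    R(M0) under T(z), whatever z is ([IV_pencilP]).

    The operator A0 is boundedly invertible ([compress_M0_invertible]).  Let
    B_t be the inverse of T(t) for large real t, so that the B_t are uniformly
    bounded.  Applying B_t to T(t) x gives t B_t M0 x = x - B_t M1 x, so on
    R(M0) the operators t B_t are pointwise bounded, and Banach-Steinhaus on
    the Banach space R(M0) gives a constant K with |t B_t y| <= K |y| for all y
    in R(M0) ([scaled_resolvent_bounded]).
    - If x is in IV, with M1 x = M0 w, then x = t B_t M0 x + B_t M0 w, where the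
      last term has size O(1/t); hence |x| <= K |M0 x| ([IV_bounded_below]).
    - If y is in R(M0), then u = t B_t y lies in IV, stays bounded, and
      y - M0 u = M1 u / t tends to 0, so M0(IV) is dense in R(M0)
      ([M0_IV_dense]).
    An operator on a Banach space that is bounded below and has dense range is
    invertible ([dense_range_invertible]).

    Consequently z + A0^-1 A1 = A0^-1 (z A0 + A1), and z A0 + A1 is the
    restriction of T(z) to IV -> R(M0).  It remains to see that T(z) is
    invertible if and only if this restriction is.  If T(z) is invertible, then
    its inverse maps R(M0) into IV ([invertible_pencil_IV]).  Conversely let S
    be the inverse of the restriction and fix w with T(w) invertible.  As
    T(z) T(w)^-1 y = y + (z - w) M0 T(w)^-1 y, and the last term is in R(M0),
    T(w)^-1 - (z - w) S M0 T(w)^-1 is a right inverse of T(z); and T(z) is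
    injective because its kernel lies in IV ([invertible_IV_pencil]).

    Two classical facts are proved on the way.  The orthogonal projection onto
    a closed subspace exists, so the adjoint of the embedding is indeed this
    projection ([adjop_embopK]).  The uniform boundedness principle for complex
    scalars is deduced from the real one by restriction of scalars
    ([uniform_boundedness]). *)

(** * Bounded operators *)

Lemma norm_RRe (R : realType) (V : normedModType R[i]) (x : V) :
  (complex.Re `|x|)%:C%C = `|x|.
Proof. by rewrite RRe_real// normr_real. Qed.

Lemma ler_addgt0C (R : realType) (x y : R[i]) :
  x \is Num.real -> y \is Num.real ->
  (forall e : R, 0 < e -> x <= y + e%:C) -> x <= y.
Proof.
move=> xr yr xy; rewrite -(RRe_real xr) -(RRe_real yr) lecR.
apply/ler_addgt0Pr => e e0.
by rewrite -lecR rmorphD /= !RRe_real// xy.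
Qed.

Lemma bopB (R : realType) (V W : normedModType R[i]) (A : bounded_op V W) x y :
  A (x - y) = A x - A y.
Proof. exact: linearB. Qed.

Lemma bopP (R : realType) (V W : normedModType R[i]) (A : bounded_op V W)
    a x y :
  A (a *: x + y) = a *: A x + A y.
Proof. exact: linearP. Qed.

Lemma bopZ (R : realType) (V W : normedModType R[i]) (A : bounded_op V W) a x :
  A (a *: x) = a *: A x.
Proof. exact: linearZ. Qed.

Lemma unit_ball_bound (R : realType) (V W : normedModType R[i])
    (A : bounded_op V W) (M : R[i]) :
  (forall x, `|x| <= 1 -> `|A x| <= M) -> forall x, `|A x| <= M * `|x|.
Proof.
move=> AM x; have [->|x0] := eqVneq x 0.
  by rewrite linear0 !normr0 mulr0.
have nx0 : 0 < `|x| by rewrite normr_gt0.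
rewrite -ler_pdivrMr// mulrC.
have -> : `|x|^-1 * `|A x| = `|A (`|x|^-1 *: x)|.
  by rewrite bopZ normrZ ger0_norm ?invr_ge0.
by apply: AM; rewrite normrZ ger0_norm ?invr_ge0// mulVf ?gt_eqF.
Qed.

Lemma opnorm_bound (R : realType) (V W : normedModType R[i])
    (A : bounded_op V W) x : `|A x| <= (opnorm A)%:C * `|x|.
Proof.
apply: unit_ball_bound => {}x x1.
have [K K0 AK] := bop_bound A.
rewrite -norm_RRe lecR; apply: ub_le_sup; last by exists x.
exists (complex.Re K) => _ [u /= u1 <-].
rewrite -lecR norm_RRe RRe_real ?ger0_real// (le_trans (AK u))//.
by rewrite ler_piMr.
Qed.

Lemma invertible_inverse (R : realType) (V W : normedModType R[i])
    (A : bounded_op V W) : invertible A -> is_inverse A (invop A).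
Proof.
by move=> [B AB]; exact: (@xgetPex _ 0 (is_inverse A) (ex_intro _ B AB)).
Qed.

Lemma invertible_oppP (R : realType) (V W : normedModType R[i])
    (A : bounded_op V W) : invertible (- A) <-> invertible A.
Proof.
have inv_opp (C : bounded_op V W) : invertible C -> invertible (- C).
  move=> [B [CB BC]]; exists (- B); split=> x.
    by change (- B (- C x) = x); rewrite linearN opprK; exact: CB.
  by change (- C (- B x) = x); rewrite linearN opprK; exact: BC.
by split=> [/inv_opp|/inv_opp//]; rewrite opprK.
Qed.

(** * Uniform boundedness over the complex numbers *)

(** An alias of [V] that carries the real structure obtained by restricting
    scalars to [R] and taking the real part of the norm; a separate name keeps
    it from competing with the complex structure of [V]. *)
Definition realified (R : realType) (V : normedModType R[i]) : Type := V.

Section Realified.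
Context (R : realType) (V : normedModType R[i]).
Let VR := realified V.
HB.instance Definition _ := GRing.Zmodule.copy VR V.
Let scale (a : R) (x : VR) : VR := a%:C *: (x : V).
Let scaleA a b (x : VR) : scale a (scale b x) = scale (a * b) x.
Proof. by rewrite /scale scalerA rmorphM. Qed.
Let scale1 : left_id 1 scale.
Proof. by move=> x; rewrite /scale scale1r. Qed.
Let scaleDr : right_distributive scale +%R.
Proof. by move=> a x y; rewrite /scale scalerDr. Qed.
Let scaleDl x : {morph scale^~ x : a b / a + b}.
Proof. by move=> a b; rewrite /scale rmorphD scalerDl. Qed.
HB.instance Definition _ :=
  GRing.Zmodule_isLmodule.Build R VR scaleA scale1 scaleDr scaleDl.
Let nrm (x : VR) : R := complex.Re `|x : V|.
Let nrmD x y : nrm (x + y) <= nrm x + nrm y.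
Proof. by rewrite -lecR rmorphD /= !norm_RRe; exact: ler_normD. Qed.
Let nrmZ l x : nrm (l *: x) = `|l| * nrm x.
Proof.
apply/complexI; rewrite rmorphM /= !norm_RRe [LHS]normrZ.
by rewrite normc_def /= expr0n addr0 sqrtr_sqr.
Qed.
Let nrm_eq0 x : nrm x = 0 -> x = 0.
Proof.
by move=> x0; apply/(@normr0_eq0 _ V); rewrite -norm_RRe [X in X%:C]x0.
Qed.
HB.instance Definition _ := Lmodule_isNormed.Build R VR nrmD nrmZ nrm_eq0.

Lemma realified_norm (x : VR) : (`|x|)%:C = `|x : V|.
Proof. exact: norm_RRe. Qed.
End Realified.

Section Complete.
Context (R : realType) (V : completeNormedModType R[i]).
Let VR := realified V.

Lemma realified_complete (F : set_system VR) :
  ProperFilter F -> cauchy F -> cvg F.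
Proof.
move=> FF /cauchyP Fc.
have Gc : @cauchy V F.
  apply/cauchyP => e e0.
  have eE : (complex.Re e)%:C = e by rewrite RRe_real// gtr0_real.
  have e0' : 0 < complex.Re e by rewrite -ltcR eE.
  have [x xF] := Fc _ e0'.
  exists x; apply: filterS xF => y; rewrite -!ball_normE /=.
  by rewrite -ltcR realified_norm eE.
have /cvg_ex[l Gl] : cvg (F : set_system V) by exact: cauchy_cvg.
apply/cvg_ex; exists l.
apply/cvgrPdist_lt => e e0.
have e0' : 0 < e%:C by rewrite ltcR.
have Fl : F (@ball _ V (l : V) e%:C) by exact/Gl/nbhsx_ballx.
apply: (@filterS VR F _ _ _ _ Fl) => y; rewrite -ball_normE /=.
by rewrite -realified_norm ltcR.
Qed.

HB.instance Definition _ :=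
  Uniform_isComplete.Build (realified V) realified_complete.
End Complete.

(** The operators of [F] are also linear over [R], so the real
    Banach-Steinhaus theorem applies to them between the realified spaces. *)
Theorem uniform_boundedness (R : realType) (V : completeNormedModType R[i])
    (W : normedModType R[i]) (F : set (bounded_op V W)) :
  (forall x, exists M : R[i], forall A, F A -> `|A x| <= M) ->
  exists2 M : R[i], 0 <= M & forall A, F A -> forall x, `|A x| <= M * `|x|.
Proof.
move=> Fpt.
pose G : set (realified V -> realified W) :=
  [set f | exists2 A : bounded_op V W, F A & f = bop_fun A].
(* The radius 1 gives a bound on the unit ball. *)
have [|x|M GM] := @Banach_Steinhauss R (realified V) (realified W) G _ _ 1.
- move=> _ [A FA ->]; split.
    move=> r; have [K K0 AK] := bop_bound A.
    exists (complex.Re K * r) => x xr.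
    rewrite -lecR realified_norm rmorphM /= (RRe_real (ger0_real K0)).
    by rewrite (le_trans (AK x))// ler_wpM2l// -realified_norm lecR.
  by move=> a x y; exact: (linearP A).
- have [M FM] := Fpt x; exists (complex.Re M) => _ [A FA ->].
  have AM := FM _ FA.
  rewrite -lecR realified_norm RRe_real//.
  exact/ger0_real/(le_trans _ AM).
exists `|M|%:C; first by rewrite ler0c.
move=> A FA; apply: unit_ball_bound => x x1.
apply: (@le_trans _ _ M%:C); last by rewrite lecR ler_norm.
rewrite -realified_norm lecR; apply: GM; first by exists A.
by rewrite -lecR realified_norm.
Qed.

(** * Invertibility from a lower bound and dense range *)

(** Cantor's intersection theorem, without closedness: the limit point is only
    claimed to be adherent to each [E e].  The sets generate a Cauchy
    filter. *)
Lemma nested_sets_limit (R : realType) (V : completeNormedModType R[i])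
    (E : R -> set V) :
  (forall e, 0 < e -> E e !=set0) ->
  (forall e e', e <= e' -> E e `<=` E e') ->
  (forall d, 0 < d -> exists2 e, 0 < e &
     forall x y, E e x -> E e y -> `|x - y| < d%:C) ->
  exists l, forall e d, 0 < e -> 0 < d -> exists2 x, E e x & `|l - x| < d%:C.
Proof.
move=> E0 Emono Ediam.
pose F := filter_from [set e : R | 0 < e] E.
have FF : ProperFilter F.
  apply: filter_from_proper; last exact: E0.
  apply: filter_from_filter; first by exists 1 => /=.
  move=> e e' e0 e0'; exists (Num.min e e'); first by rewrite /= lt_min e0.
  by move=> x Ex; split; apply: Emono Ex; rewrite ge_min lexx ?orbT.
have Fc : cauchy F.
  apply: cauchy_exP => d d0.
  have dE : (complex.Re d)%:C = d by rewrite RRe_real// gtr0_real.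
  have [|e e0 Ed] := Ediam (complex.Re d); first by rewrite -ltcR dE.
  have [x Ex] := E0 _ e0; exists x, e => // y Ey.
  by rewrite -ball_normE /= -dE; exact: Ed.
have /cvg_ex[l Fl] : cvg F by exact: cauchy_cvg.
exists l => e d e0 d0.
have d0' : 0 < d%:C by rewrite ltcR.
have Fb : F (ball l d%:C) by exact/Fl/nbhsx_ballx.
have FE : F (E e) by exists e.
have [x [Ex lx]] := filter_ex (filterI FE Fb).
by exists x; move: lx; rewrite -?ball_normE.
Qed.

(** The lower bound makes approximate preimages of a point cluster, so
    they converge, by completeness of [V], to an exact preimage; it also makes
    the inverse bounded. *)
Theorem dense_range_invertible (R : realType) (V : completeNormedModType R[i])
    (W : normedModType R[i]) (A : bounded_op V W) (c : R[i]) :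
  (forall x, `|x| <= c * `|A x|) ->
  (forall y (e : R), 0 < e -> exists x, `|y - A x| < e%:C) ->
  invertible A.
Proof.
move=> Ac Adense.
(* If [c] is not positive then [V] is trivial and any constant will do. *)
wlog c0 : c Ac / 0 < c.
  move=> /(_ (`|c| + 1)); apply; last by rewrite ltr_pwDr.
  move=> x; have [->|x0] := eqVneq x 0.
    by rewrite normr0 mulr_ge0// addr_ge0.
  have Ax0 : 0 < `|A x|.
    rewrite lt_def normr_ge0 andbT; apply: contra_neq x0 => Ax0.
    by have := Ac x; rewrite Ax0 mulr0 normr_le0 => /eqP.
  have : 0 <= c * `|A x| by rewrite (le_trans _ (Ac x)).
  rewrite pmulr_lge0// => c0; rewrite (le_trans (Ac x))// ler_pM2r//.
  by rewrite ger0_norm// lerDl.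
have surj y : exists x, A x = y.
  have [|e e' ee' x|d d0|l ly] :=
    @nested_sets_limit R V (fun e => [set x | `|y - A x| < e%:C]).
  - by move=> e e0; exact: Adense.
  - by move=> /lt_le_trans; apply; rewrite lecR.
  - have cE : (complex.Re c)%:C = c by rewrite RRe_real// gtr0_real.
    have rc0 : 0 < complex.Re c by rewrite -ltcR cE.
    exists (d / (2 * complex.Re c)); first by rewrite divr_gt0// mulr_gt0.
    move=> x x' /= xy x'y; apply: (le_lt_trans (Ac _)); rewrite bopB.
    rewrite (_ : A x - A x' = (y - A x') - (y - A x)); last first.
      by rewrite opprB [RHS]addrC addrA subrK.
    apply: (@lt_le_trans _ _ (c * ((d / (2 * complex.Re c))%:C *+ 2))).
      rewrite ltr_pM2l// mulr2n (le_lt_trans (ler_normB _ _))//.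
      exact: ltrD.
    rewrite -{1}cE -rmorphMn -rmorphM /= lecR.
    rewrite le_eqVlt; apply/orP; left; apply/eqP.
    by field; rewrite gt_eqF.
  - exists l; apply/eqP; rewrite -subr_eq0 -normr_le0.
    have [K K0 AK] := bop_bound A.
    apply: ler_addgt0C => //; first exact: normr_real.
    move=> e e0; rewrite add0r.
    have KE : (complex.Re K)%:C = K by rewrite RRe_real// ger0_real.
    have rK0 : 0 <= complex.Re K by rewrite -ler0c KE.
    have K1 : 0 < complex.Re K + 1 by rewrite ltr_pwDr.
    have [||x xy lx] := ly (e / 2) (e / (2 * (complex.Re K + 1))).
    + by rewrite divr_gt0.
    + by rewrite divr_gt0// mulr_gt0.
    rewrite (_ : A l - y = A (l - x) - (y - A x)); last first.
      by rewrite bopB opprB addrA subrK.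
    rewrite (le_trans (ler_normB _ _))//.
    rewrite (_ : e = e / 2 + e / 2); last by rewrite -splitr.
    rewrite rmorphD /= lerD ?(ltW xy)//.
    rewrite (le_trans (AK _))//.
    rewrite (le_trans (ler_wpM2l K0 (ltW lx)))//.
    rewrite -KE -rmorphM /= lecR mulrA ler_pdivrMr ?mulr_gt0//.
    nra.
have /choice[f fA] := surj.
have Af : cancel A f.
  move=> x; apply/eqP; rewrite -subr_eq0 -normr_le0 (le_trans (Ac _))//.
  by rewrite bopB fA subrr normr0 mulr0.
have bf : bounded_linear f.
  split=> [a x y|]; first by apply: (can_inj Af); rewrite bopP !fA.
  by exists c => y; rewrite (le_trans (Ac _))// fA.
by exists (mk_bop bf).
Qed.

(** * Orthogonal projection onto a closed subspace *)

Lemma parallelogram (R : realType) (H : hilbertType R) (u v : H) :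
  `|u + v| ^+ 2 + `|u - v| ^+ 2 = 2 * (`|u| ^+ 2 + `|v| ^+ 2).
Proof.
rewrite -!inner_norm dnormD dnormB [in LHS]addrACA subrr addr0.
by rewrite mulrDr !mulr_natl !mulr2n addrACA.
Qed.

Section Projection.
Context (R : realType) (H : hilbertType R) (S : closed_subspace H).
Implicit Types (y : H) (s v : csub S).

Definition in_csub (x : H) (Sx : csub_set S x) : csub S := CSub (mem_set Sx).

(** Near-minimizers of the distance to [y] cluster, by the parallelogram
    identity applied to [y - s] and [y - s']: the norm of their half sum is at
    least the distance of [y] to [S], since the midpoint of [s] and [s'] is in
    [S]. *)
Lemma best_approximation y :
  exists p : csub S, forall s, `|y - csub_val p| <= `|y - csub_val s|.
Proof.
pose dist s : R := complex.Re `|y - csub_val s|.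
have distE s : (dist s)%:C = `|y - csub_val s| by exact: norm_RRe.
have dist0 s : 0 <= dist s by rewrite -ler0c distE.
pose D := range dist; pose d := inf D.
have D0 : has_inf D.
  by split; [exists (dist 0), 0 | exists 0 => _ [s _ <-]].
have dD s : d <= dist s by apply: ge_inf; [exact: D0.2 | exists s].
have d0 : 0 <= d by apply: lb_le_inf; [exact: D0.1 | move=> _ [s _ <-]].
have [|e e' ee' s|r r0|p ply] :=
  @nested_sets_limit R (csub S) (fun e => [set s | dist s < d + e]).
- move=> e e0; have [_ [s _ <-] se] := inf_adherent e0 D0.
  by exists s.
- by move=> /lt_le_trans; apply; rewrite lerD2l.
- (* The identity gives |s - s'|^2 <= 4 (d + e)^2 - 4 d^2 = e (8 d + 4 e), which
     is less than r^2 for this choice of e. *)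
  pose e := Num.min 1 (r ^+ 2 / (8 * d + 8)).
  have q0 : 0 < 8 * d + 8 by rewrite ltr_wpDl// mulr_ge0.
  have e0 : 0 < e by rewrite lt_min ltr01 divr_gt0// exprn_gt0.
  exists e => // s s' /= sd s'd.
  have e1 : e <= 1 by rewrite ge_min lexx.
  have er : e * (8 * d + 8) <= r ^+ 2.
    by rewrite -ler_pdivlMr// ge_min lexx orbT.
  have mid : 2 * d <= complex.Re `|(y - csub_val s) + (y - csub_val s')|.
    have := dD (2^-1 *: (s + s')); rewrite -lecR => dm.
    rewrite -lecR norm_RRe rmorphM /= rmorph_nat.
    rewrite (_ : y - csub_val s + (y - csub_val s') =
                 2 *: (y - csub_val (2^-1 *: (s + s')))).
      by rewrite normrZ normr_nat ler_pM2l// -distE.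
    rewrite scalerBr /= scalerA divff ?pnatr_eq0// scale1r.
    by rewrite scaler_nat mulr2n addrACA opprD.
  have -> : `|s - s'| = `|(y - csub_val s) - (y - csub_val s')|.
    rewrite opprB [X in _ = `|X|]addrC [in RHS]addrA subrK.
    by rewrite -[RHS]normrN opprB.
  set u := y - csub_val s in mid *; set v := y - csub_val s' in mid *.
  have par : complex.Re `|u + v| ^+ 2 + complex.Re `|u - v| ^+ 2 =
      2 * (dist s ^+ 2 + dist s' ^+ 2).
    apply: complexI; rewrite rmorphM rmorph_nat !rmorphD !rmorphXn /= !norm_RRe.
    exact: parallelogram.
  rewrite -norm_RRe ltcR.
  set M := complex.Re `|u + v| in mid par.
  set X := complex.Re `|u - v| in par *.
  have X0 : 0 <= X by rewrite -ler0c norm_RRe.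
  rewrite ltNge; apply/negP => rX.
  have rX2 : r ^+ 2 <= X ^+ 2 by rewrite lerXn2r ?nnegrE// ltW.
  have M2 : (2 * d) ^+ 2 <= M ^+ 2.
    by rewrite lerXn2r ?nnegrE ?(le_trans _ mid) ?mulr_ge0.
  have s2 : dist s ^+ 2 <= (d + e) ^+ 2.
    by rewrite lerXn2r ?nnegrE ?addr_ge0// ltW.
  have s'2 : dist s' ^+ 2 <= (d + e) ^+ 2.
    by rewrite lerXn2r ?nnegrE ?addr_ge0// ltW.
  nra.
- exists p => s; rewrite -!distE lecR; apply: le_trans (dD s).
  apply/ler_addgt0Pr => e e0.
  have e20 : 0 < e / 2 by rewrite divr_gt0.
  have [s' /= s'd ps'] := ply _ _ e20 e20.
  rewrite -lecR distE.
  rewrite (_ : y - csub_val p =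
      (y - csub_val s') - (csub_val p - csub_val s')); last first.
    by rewrite opprB addrA subrK.
  rewrite (le_trans (ler_normB _ _))// [e]splitr addrA !rmorphD /=.
  by rewrite lerD//; [rewrite -distE -rmorphD lecR ltW | exact: ltW].
Qed.

(** Moving the nearest point [p] along [v] cannot decrease the distance to [y],
    while the step [a] below would decrease its square by
    [`|t| ^+ 2 / inner w w]. *)
Lemma projection_orthogonal y :
  exists p : csub S, forall v, inner (y - csub_val p) (csub_val v) = 0.
Proof.
have [p pmin] := best_approximation y; exists p => v.
have [->|v0] := eqVneq v 0; first by rewrite linear0r.
set u := y - csub_val p; set w := csub_val v; set t := inner u w.
have w0 : 0 < inner w w by rewrite dnorm_gt0.
pose a := t / inner w w.
have : inner u u <= inner (u - a *: w) (u - a *: w).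
  rewrite !inner_norm lerXn2r ?nnegrE//.
  by have := pmin (p + a *: v); rewrite /= opprD addrA.
have tw : inner u (a *: w) = `|t| ^+ 2 / inner w w.
  rewrite linearZr_LR /= -/t rmorphM fmorphV /= (geC0_conj (ltW w0)).
  by rewrite normCK mulrC mulrA.
rewrite (dnormB _ u (a *: w)) dnormZ tw geC0_conj; last first.
  by rewrite divr_ge0 ?exprn_ge0// ltW.
rewrite normrM normfV (ger0_norm (ltW w0)) exprMn exprVn.
have -> : `|t| ^+ 2 * inner w w ^- 2 * inner w w = `|t| ^+ 2 / inner w w.
  by field; rewrite gt_eqF.
rewrite opprD addrA addrK lerBrDl gerDr => tle.
apply/eqP; rewrite -normr_eq0 -sqrf_eq0 eq_le exprn_ge0// andbT.
by rewrite -(@pmulr_lle0 _ (inner w w)^-1) ?invr_gt0.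
Qed.

(** Orthogonality of [y - p] to [S] says that the projection [p] of [y]
    represents the functional [inner _ y] on [S]; representatives are unique, so
    the projection is linear, and it is bounded by Pythagoras. *)
Lemma adjop_embop_exists : exists B : bounded_op H (csub S),
  forall s y, inner (embop S s) y = inner s (B y).
Proof.
have exB y : exists p : csub S, forall s,
    inner (csub_val s) y = inner (csub_val s) (csub_val p).
  have [p pv] := projection_orthogonal y; exists p => s.
  apply/eqP; rewrite -subr_eq0 -linearBr /= hermC /= pv.
  by rewrite rmorph0 mulr0.
have /choice[B BE] := exB.
have Buniq (p q : csub S) : (forall s : csub S,
    inner (csub_val s) (csub_val p) = inner (csub_val s) (csub_val q)) -> p = q.
  move=> pq; apply/eqP; rewrite -subr_eq0 -(dnorm_eq0 inner) linearBr subr_eq0.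
  exact/eqP/(pq (p - q)).
have bB : bounded_linear B.
  split=> [a x y|].
    apply: Buniq => s; rewrite -BE !linearPr /=.
    by rewrite -!BE.
  exists 1 => y; rewrite mul1r.
  set p := csub_val (B y).
  have orth : inner p (y - p) = 0 by rewrite linearBr /= -BE subrr.
  have : inner p p <= inner y y.
    rewrite -[y in leRHS](subrK p) [y - p + p]addrC dnormD orth rmorph0 !addr0.
    by rewrite lerDl dnorm_ge0.
  by rewrite !inner_norm ler_pXn2r ?nnegrE.
by exists (mk_bop bB) => s y; exact: BE.
Qed.

Lemma adjop_embopK : cancel (embop S) (adjop (embop S)).
Proof.
move=> s; have [B BE] := adjop_embop_exists.
pose is_adj (B : bounded_op H (csub S)) :=
  forall x y, inner (embop S x) y = inner x (B y).
have adjE : is_adj (adjop (embop S)).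
  by have := @xgetPex _ 0 is_adj (ex_intro _ B BE).
apply/eqP; rewrite -subr_eq0 -(dnorm_eq0 inner) linearBr /=.
by rewrite -adjE subrr.
Qed.

Lemma adjop_embop_val x : csub_set S x -> csub_val (adjop (embop S) x) = x.
Proof.
by move=> Sx; exact: (congr1 (@csub_val _ _ _) (adjop_embopK (in_csub Sx))).
Qed.

End Projection.

(** * The pencil on its space of consistent initial values *)

Section Pencil.
Context (R : realType) (H : hilbertType R) (M0 M1 : bounded_op H H).
Context (closed_range : closed (range M0)).
Local Notation RM0 := (csub (range_csub closed_range)).
Local Notation IVM := (csub (IV_csub M1 closed_range)).
Local Notation inR := (@in_csub _ _ (range_csub closed_range) _).
Local Notation inIV := (@in_csub _ _ (IV_csub M1 closed_range) _).
Local Notation T := (pencil M0 M1).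
Local Notation comp := (compress M1 closed_range).

Lemma pencilE z x : T z x = z *: M0 x + M1 x.
Proof. by []. Qed.

Lemma compressE (A : bounded_op H H) (x : IVM) :
  range M0 (A (csub_val x)) -> csub_val (comp A x) = A (csub_val x).
Proof.
exact: (@adjop_embop_val _ _ (range_csub closed_range)).
Qed.

Lemma compress_M0E (x : IVM) : csub_val (comp M0 x) = M0 (csub_val x).
Proof. by rewrite compressE//; exists (csub_val x). Qed.

Lemma compress_M1E (x : IVM) : csub_val (comp M1 x) = M1 (csub_val x).
Proof. by rewrite compressE//; exact: (set_mem (csub_valP x)). Qed.

(** [z *: M0 x] is always in the range of [M0]. *)
Lemma IV_pencilP z x : IV M0 M1 x <-> range M0 (T z x).
Proof.
split=> -[w _ wE].
  by exists (z *: x + w) => //; rewrite bopP wE.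
by exists (w - z *: x) => //; rewrite bopB wE pencilE bopZ addrC addKr.
Qed.

Lemma regular_resolvent : regular_pencil M0 M1 ->
  exists nu K : R, forall t : R, nu < t -> exists2 B, is_inverse (T t%:C) B &
    forall x, `|B x| <= K%:C * `|x|.
Proof.
move=> [nu [Tinv [K TK]]]; exists nu, K => t nut; exists (invop (T t%:C)).
  exact/invertible_inverse/Tinv.
move=> x; rewrite (le_trans (opnorm_bound _ x))// ler_wpM2r// lecR.
exact: TK.
Qed.

Lemma resolvent_M0 (t : R[i]) (B : bounded_op H H) x :
  is_inverse (T t) B -> t *: B (M0 x) = x - B (M1 x).
Proof.
by move=> [BT _]; rewrite -[X in X - _]BT pencilE bopP addrK.
Qed.

Context (regular : regular_pencil M0 M1).

(** On the range of [M0], [resolvent_M0] bounds [t *: B (M0 w)] independently of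
    [t], but by a quantity that depends on the preimage [w] and not only on the
    norm of [M0 w]; uniform boundedness removes this dependence. *)
Lemma scaled_resolvent_bounded : exists nu K : R, forall t : R, nu < t ->
  exists2 B, is_inverse (T t%:C) B &
    forall y, range M0 y -> `|t%:C *: B y| <= K%:C * `|y|.
Proof.
have [nu [K TK]] := regular_resolvent regular.
pose F := [set A : bounded_op RM0 H | exists2 t : R, nu < t & exists2 B,
  is_inverse (T t%:C) B /\ (forall x, `|B x| <= K%:C * `|x|) &
  A = t%:C *: compop B (embop (range_csub closed_range))].
have [y|C C0 FC] := @uniform_boundedness R RM0 H F.
  have [w _ wE] := set_mem (csub_valP y).
  exists (`|w| + K%:C * `|M1 w|) => _ [t _ [B [TB BK] ->]].
  rewrite (_ : _ y = t%:C *: B (M0 w)); last by rewrite wE.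
  by rewrite resolvent_M0// (le_trans (ler_normB _ _))// lerD.
exists nu, (complex.Re C) => t nut; have [B TB BK] := TK t nut.
exists B => // y Ry; rewrite RRe_real ?ger0_real//.
apply: (FC (t%:C *: compop B (embop (range_csub closed_range))) _ (inR Ry)).
by exists t => //; exists B.
Qed.

(** For [M1 x = M0 w], [x] is [t *: B (M0 x)] up to [B (M0 w)], which is of
    order [1 / t] by [scaled_resolvent_bounded]. *)
Lemma IV_bounded_below :
  exists c : R, forall x, IV M0 M1 x -> `|x| <= c%:C * `|M0 x|.
Proof.
have [nu [K TK]] := scaled_resolvent_bounded; exists K => x [w _ wE].
apply: ler_addgt0C => [||e e0]; first exact: normr_real.
  by rewrite realM ?normr_real//; apply/complex_realP; exists K.
pose q := complex.Re (K%:C * `|M0 w|).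
have qE : q%:C = K%:C * `|M0 w|.
  by rewrite RRe_real// realM ?normr_real//; apply/complex_realP; exists K.
(* This [t] is beyond [nu], positive, and makes [q / t] at most [e]. *)
pose t := Num.max (nu + 1) (Num.max 1 (q / e)).
have t1 : 1 <= t by rewrite !le_max lexx orbT.
have t0 : 0 < t by rewrite (lt_le_trans ltr01).
have tC0 : t%:C != 0 by rewrite gt_eqF// ltcR.
have [|B TB BK] := TK t; first by rewrite lt_max ltrDl ltr01.
have xE : x = t%:C *: B (M0 x) + t%:C^-1 *: (t%:C *: B (M0 w)).
  by rewrite scalerA mulVf// scale1r (resolvent_M0 _ TB) wE subrK.
rewrite {1}xE; apply: (le_trans (ler_normD _ _)); rewrite lerD//.
  by apply: BK; exists x.
rewrite normrZ normfV gtr0_norm ?ltcR// mulrC ler_pdivrMr ?ltcR//.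
apply: (le_trans (BK _ _)); first by exists w.
by rewrite -qE -rmorphM lecR mulrC -ler_pdivrMr// !le_max lexx !orbT.
Qed.

(** The approximate preimage is [u := t *: B y] for large [t]: as [T t u] is
    [t *: y], the error [y - M0 u] is [M1 u / t], and [u] is bounded in [t]. *)
Lemma M0_IV_dense y (e : R) : range M0 y -> 0 < e ->
  exists2 x, IV M0 M1 x & `|y - M0 x| < e%:C.
Proof.
move=> Ry e0; have [nu [K TK]] := scaled_resolvent_bounded.
have [K1 K10 M1K] := bop_bound M1.
pose q := complex.Re (K1 * (K%:C * `|y|)).
have qE : q%:C = K1 * (K%:C * `|y|).
  rewrite RRe_real// realM ?(ger0_real K10)// realM ?normr_real//.
  by apply/complex_realP; exists K.
(* This [t] is beyond [nu], positive, and makes [q / t] less than [e]. *)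
pose t := Num.max (nu + 1) (Num.max 1 ((q + 1) / e)).
have t1 : 1 <= t by rewrite !le_max lexx orbT.
have t0 : 0 < t by rewrite (lt_le_trans ltr01).
have [|B TB BK] := TK t; first by rewrite lt_max ltrDl ltr01.
have Tu : T t%:C (t%:C *: B y) = t%:C *: y by rewrite bopZ TB.2.
have M1u : M1 (t%:C *: B y) = t%:C *: (y - M0 (t%:C *: B y)).
  by rewrite scalerBr -Tu pencilE addrC addKr.
exists (t%:C *: B y).
  apply/(IV_pencilP t%:C); rewrite Tu; case: Ry => w _ <-.
  by exists (t%:C *: w) => //; rewrite bopZ.
rewrite -(ltr_pM2l (_ : 0 < t%:C)) ?ltcR//.
rewrite -[X in X * `|_|]gtr0_norm ?ltcR// -normrZ -M1u.
rewrite (le_lt_trans (M1K _))// (le_lt_trans (ler_wpM2l K10 (BK _ Ry)))//.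
rewrite -qE -rmorphM ltcR -ltr_pdivrMr// !lt_max.
by rewrite [X in _ || (_ || X)]ltr_pM2r ?invr_gt0// ltrDl ltr01 !orbT.
Qed.

Lemma compress_M0_invertible : invertible (comp M0).
Proof.
have [c cP] := IV_bounded_below.
apply: (@dense_range_invertible _ IVM RM0 _ c%:C) => [x|y e e0].
  change (`|csub_val x| <= c%:C * `|csub_val (comp M0 x)|).
  by rewrite compress_M0E cP//; exact: (set_mem (csub_valP x)).
have [x IVx yx] := M0_IV_dense (set_mem (csub_valP y)) e0.
exists (inIV IVx).
change (`|csub_val y - csub_val (comp M0 (inIV IVx))| < e%:C).
by rewrite compress_M0E.
Qed.

Let IVop z : bounded_op IVM IVM :=
  z *: idop IVM + compop (invop (comp M0)) (comp M1).

(** Multiplied by the invertible [comp M0], the operator whose invertibility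
    defines [sigma_IV] is the restriction of the pencil. *)
Lemma compress_M0_IVop z (x : IVM) :
  csub_val (comp M0 (IVop z x)) = T z (csub_val x).
Proof.
have [_ M0V] := invertible_inverse compress_M0_invertible.
have -> : IVop z x = z *: x + invop (comp M0) (comp M1 x) by [].
rewrite bopP M0V.
change (z *: csub_val (comp M0 x) + csub_val (comp M1 x) = T z (csub_val x)).
by rewrite compress_M0E compress_M1E.
Qed.

Lemma IVop_eq z (x y : IVM) :
  csub_val (comp M0 y) = T z (csub_val x) -> IVop z x = y.
Proof.
move=> yx; have [M0V _] := invertible_inverse compress_M0_invertible.
apply: (can_inj M0V); apply: val_inj; rewrite [RHS]yx.
exact: compress_M0_IVop.
Qed.

(** A regular point [w] of the pencil reduces solving [T z x = y] to right-hand
    sides in the range of [M0], on which the inverse on IV is available. *)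
Lemma invertible_IV_pencil z : invertible (IVop z) -> invertible (T z).
Proof.
move=> [B [EB BE]].
have [_ M0K] := invertible_inverse compress_M0_invertible.
have [nu [K TK]] := regular_resolvent regular.
have [|Bw TBw _] := TK (nu + 1); first by rewrite ltrDl.
set w := (nu + 1)%:C in TBw.
pose q : bounded_op H RM0 :=
  compop (adjop (embop (range_csub closed_range))) M0.
have qE x : csub_val (q x) = M0 x.
  by apply: (@adjop_embop_val _ _ (range_csub closed_range)); exists x.
pose S : bounded_op RM0 H :=
  compop (embop (IV_csub M1 closed_range)) (compop B (invop (comp M0))).
have TS r : T z (S r) = csub_val r by rewrite -compress_M0_IVop BE M0K.
have T_inj x : T z x = 0 -> x = 0.
  move=> Tx; have IVx : IV M0 M1 x.
    by apply/(IV_pencilP z); rewrite Tx; exists 0 => //; rewrite linear0.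
  have Ex : IVop z (inIV IVx) = 0.
    by apply: IVop_eq; rewrite [RHS]Tx linear0.
  have := EB (inIV IVx); rewrite Ex linear0.
  by move=> /(congr1 (@csub_val _ _ _)) x0; exact: esym x0.
pose G : bounded_op H H := Bw - (z - w) *: compop S (compop q Bw).
have TG : cancel G (T z).
  move=> y; have -> : G y = Bw y - (z - w) *: S (q (Bw y)) by [].
  rewrite bopB bopZ TS qE -[RHS](TBw.2 y) !pencilE.
  by rewrite scalerBl opprB addrC addrA subrK.
exists G; split=> // x; apply/eqP; rewrite -subr_eq0; apply/eqP/T_inj.
by rewrite bopB TG subrr.
Qed.

(** The inverse of [T z] maps the range of [M0] into IV, by [IV_pencilP]; the
    adjoint of the embedding only serves to corestrict it to IV. *)
Lemma invertible_pencil_IV z : invertible (T z) -> invertible (IVop z).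
Proof.
move=> [G [TG GT]].
pose f : bounded_op RM0 IVM := compop (adjop (embop (IV_csub M1 closed_range)))
  (compop G (embop (range_csub closed_range))).
have fE r (x : IVM) : csub_val r = T z (csub_val x) -> f r = x.
  move=> rx.
  have -> : f r =
    adjop (embop (IV_csub M1 closed_range)) (G (csub_val r)) by [].
  by rewrite rx TG; exact: (adjop_embopK x).
exists (compop f (comp M0)); split=> x.
  by apply: fE; rewrite compress_M0_IVop.
apply: IVop_eq; set r := comp M0 x.
have IVr : IV M0 M1 (G (csub_val r)).
  by apply/(IV_pencilP z); rewrite GT; exact: (set_mem (csub_valP r)).
change (csub_val r = T z (csub_val (f r))).
have -> : f r = inIV IVr by apply: fE; exact: esym (GT _).
exact: esym (GT _).
Qed.

End Pencil.

Theorem theorem6p3 (R : realType) (H : hilbertType R) (M0 M1 : bounded_op H H)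
  (closed_range : closed (range M0)) (regular : regular_pencil M0 M1) :
  sigma_IV M1 closed_range = sigma_pencil M0 M1.
Proof.
apply/seteqP; split=> z /=;
  rewrite /sigma_IV /sigma_pencil /spectrum /= opprK scale0r sub0r.
  by move=> nE /invertible_oppP/(invertible_pencil_IV closed_range regular).
move=> nT /(invertible_IV_pencil regular) Tz; apply: nT.
exact/invertible_oppP.
Qed.
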